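(* Fix $\alpha<1$, real numbers $a_-,a_+>0$, and functions $p_-,p_+$ of the positive integer $r$ with $p_-(r)=\Omega(1/r)$ and $p_+(r)=O(1/r)$. Then there exist constants $\beta,c,C>0$, depending only on $\alpha,a_-,a_+,p_-,p_+$, such that the following holds. Let $n$ be a positive real number and $m\ge 2$ an integer with $n/m>\beta$, and let $(A_{i,t})_{i\in[m],\,t\in\mathbb{N}}$ be a sticky random walk with total $n$ and parameters $(p_-,p_+,a_-,a_+)$ such that $A_{i,0}\le \alpha n$ for all $i\in[m]$. Let $\tau$ be the absorption time, i.e. the first time $t$ at which exactly one of the $A_{i,t}$ is nonzero. Then $$c\,n^2\le \mathbb{E}[\tau]\le C\,n^2,$$ i.e. the expected absorption time is $\Theta(n^2)$.
   Context: Write $[m]=\{1,\dots,m\}$ and $\mathbb{N}=\{0,1,2,\dots\}$. A sticky random walk with total $n$ (a positive real) and parameters $(p_-,p_+,a_-,a_+)$, where $p_-(r)=\Omega(1/r)$ and $p_+(r)=O(1/r)$ are functions of the positive integer $r$ and $a_-,a_+>0$ are real numbers, is a stochastic process $(A_{i,t})_{i\in[m]}$, $t\in\mathbb{N}$, with values in $\{(x_1,\dots,x_m)\in\mathbb{R}^m: x_i\ge 0 \text{ for all } i,\ \sum_{i=1}^m x_i=n\}$, adapted to a filtration $(\mathcal{F}_t)$ (the history of the walk), such that for every $i\in[m]$ and $t$, with $r$ denoting the number of indices $j$ with $A_{j,t}\neq 0$: (1) $(A_{i,t})_{t\in\mathbb{N}}$ is a martingale. (2) If $A_{i,t}=0$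 then $A_{i,t+1}=0$. (3) If $A_{i,t+1}>A_{i,t}$ (''$A_{i,t}$ increases''), then $A_{j,t+1}<A_{j,t}$ (''$A_{j,t}$ decreases'') for all $j\ne i$ with $A_{j,t}>0$. (4) If $r\ge 2$ and $A_{i,t}>0$, then the probability, given the history up to time $t$, that $A_{i,t}$ increases lies between $p_-(r)$ and $p_+(r)$. (5) If $A_{i,t}$ decreases, then $a_-\le A_{i,t}-A_{i,t+1}\le a_+$. (6) $\sum_{i=1}^m A_{i,t}=n$. The absorbing states are those in which all of the $A_{i,t}$ except one are $0$. *)

(* Defs.v *)
From HB Require Import structures.
From mathcomp Require Import all_boot all_order all_algebra.
From mathcomp Require Import all_classical all_reals all_analysis.

Set Implicit Arguments.
Unset Strict Implicit.
Unset Printing Implicit Defensive.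

Import Order.TTheory GRing.Theory Num.Theory.
Import numFieldNormedType.Exports.

Local Open Scope classical_set_scope.
Local Open Scope ring_scope.

(* The bounds hold for every positive integer and not only for large r: a
   p_- that vanishes at r = 2 would allow a walk that is never absorbed. *)
Definition Omega_inv (R : realType) (p : nat -> R) : Prop :=
  exists2 k : R, 0 < k & forall r : nat, (0 < r)%N -> k / r%:R <= p r.

Definition O_inv (R : realType) (p : nat -> R) : Prop :=
  exists2 K : R, 0 < K & forall r : nat, (0 < r)%N -> `|p r| <= K / r%:R.

Definition filtration (d : measure_display) (T : measurableType d)
    (F : nat -> set (set T)) : Prop :=
  [/\ forall t, sigma_algebra [set: T] (F t),
      forall t, F t `<=` measurable
    & forall t, F t `<=` F t.+1].

(* When G is a sigma-algebra, the measurable sets of g_sigma_algebraType G are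
   exactly the elements of G. *)
Definition measurable_wrt (T : pointedType) (R : realType)
    (G : set (set T)) (X : T -> R) : Prop :=
  measurable_fun [set: g_sigma_algebraType G]
    (X : g_sigma_algebraType G -> R).

(* Y is a version of the conditional expectation E[X | G]. *)
Definition is_cond_expectation (d : measure_display) (T : measurableType d)
    (R : realType) (P : probability T R) (G : set (set T))
    (X Y : T -> R) : Prop :=
  [/\ measurable_wrt G Y,
      P.-integrable [set: T] (EFin \o Y)
    & forall B, G B ->
        (\int[P]_(w in B) (Y w)%:E = \int[P]_(w in B) (X w)%:E)%E].

Definition is_cond_probability (d : measure_display) (T : measurableType d)
    (R : realType) (P : probability T R) (G : set (set T))
    (E : set T) (Y : T -> R) : Prop :=
  is_cond_expectation P G (\1_E : T -> R) Y.

Definition martingale (d : measure_display) (T : measurableType d)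
    (R : realType) (P : probability T R) (F : nat -> set (set T))
    (X : nat -> T -> R) : Prop :=
  [/\ forall t, measurable_wrt (F t) (X t),
      forall t, P.-integrable [set: T] (EFin \o X t)
    & forall t, is_cond_expectation P (F t) (X t.+1) (X t)].

Definition num_alive (T : Type) (R : realType) (m : nat)
    (A : 'I_m -> nat -> T -> R) (t : nat) (w : T) : nat :=
  #|[set j : 'I_m | A j t w != 0]%SET|.

(* As usual for random variables, the pathwise conditions are required almost
   surely. *)
Record sticky_random_walk (d : measure_display) (T : measurableType d)
    (R : realType) (P : probability T R) (F : nat -> set (set T)) (m : nat)
    (n : R) (pminus pplus : nat -> R) (aminus aplus : R)
    (A : 'I_m -> nat -> T -> R) : Prop := StickyRandomWalk {
  srw_filtration : filtration F ;
  srw_ge0 : forall i t, {ae P, forall w, 0 <= A i t w} ;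
  srw_martingale : forall i, martingale P F (A i) ;
  srw_sticky : forall i t,
    {ae P, forall w, A i t w = 0 -> A i t.+1 w = 0} ;
  srw_increase : forall i t,
    {ae P, forall w, A i t w < A i t.+1 w ->
      forall j, j != i -> 0 < A j t w -> A j t.+1 w < A j t w} ;
  srw_prob_increase : forall i t,
    exists2 Y : T -> R,
      is_cond_probability P (F t) [set w | A i t w < A i t.+1 w] Y
    & {ae P, forall w, (2 <= num_alive A t w)%N -> 0 < A i t w ->
        pminus (num_alive A t w) <= Y w <= pplus (num_alive A t w)} ;
  srw_decrease : forall i t,
    {ae P, forall w, A i t.+1 w < A i t w ->
      aminus <= A i t w - A i t.+1 w <= aplus} ;
  srw_total : forall t, {ae P, forall w, \sum_(i < m) A i t w = n}
}.

(* Equal to +oo when the walk is never absorbed. *)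
Definition absorption_time (T : Type) (R : realType) (m : nat)
    (A : 'I_m -> nat -> T -> R) (w : T) : \bar R :=
  ereal_inf [set (t%:R)%:E | t in [set t : nat | num_alive A t w = 1%N]].

(* Main.v *)
Require Import Defs.
From HB Require Import structures.
From mathcomp Require Import all_boot all_order all_algebra.
From mathcomp Require Import all_classical all_reals all_analysis.
From mathcomp Require Import measurable_realfun.
From mathcomp Require Import ring lra.

Set Implicit Arguments.
Unset Strict Implicit.
Unset Printing Implicit Defensive.

Import Order.TTheory GRing.Theory Num.Theory.
Import numFieldNormedType.Exports.

Local Open Scope classical_set_scope.
Local Open Scope ring_scope.

(** Let r be the number of nonzero coordinates. When a coordinate goes up, the
    other r - 1 nonzero ones all go down by an amount between a_- and a_+, so
    the jump has size of order r; its conditional probability is of order 1/r.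
    Two potentials turn this into bounds on the expected absorption time, which
    is the sum over t of the probability that r is at least 2 at time t
    ([absorption_time_series], [mean_absorption_time_series]).

    Upper bound. As the coordinates are martingales, the sum S of their squares
    grows on average by the sum of the conditional variances, which is at least
    k a_-^2 (r - 1)^2 ([drift_square]). This is at least a positive constant
    until absorption, while S stays between 0 and n^2.

    Lower bound. The drift of S can be as large as r^2, so S alone does not
    exclude a fast absorption. Fix a small e > 0 and let V be the sum of the
    squares of max (A_i - e n, 0). If n/m is large, one jump is at most e n / 2,
    so only coordinates above e n / 2 contribute to the drift of V. There are
    at most 2/e of them and each has variance of order r, so the drift of V is
    linear in r ([drift_excess]). A quadratic with negative leading coefficient
    is bounded above, so V - e S has drift at most a constant D while r is at
    least 2, and no drift after absorption ([linear_minus_square_le]). But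
    V - e S starts at most at alpha n^2 and ends at least at
    ((1 - e)^2 - e) n^2, so D times the expected absorption time is at least
    a positive multiple of n^2 ([mean_absorption_time_ge]).

    Conditional expectations enter only through [cond_expectationM]: a bounded
    factor known at time t may be multiplied into the identity that defines a
    version of a conditional expectation. *)

(** * Integrals of almost surely bounded functions *)

Section expectation.
Context d (T : measurableType d) (R : realType) (P : probability T R).
Implicit Types X Y Z g : T -> R.

Lemma ae_bounded_integrable X (M : R) : measurable_fun setT X ->
  {ae P, forall w, `|X w| <= M} -> P.-integrable setT (EFin \o X).
Proof.
move=> mX bX; apply/integrableP; split; first exact/measurable_EFinP.
apply: (@le_lt_trans _ _ (\int[P]_w (`|M|)%:E)%E).
  apply: ae_ge0_le_integral => //.
  - by apply: measurableT_comp => //; exact/measurable_EFinP.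
  - by apply: filterS bX => w bw _; rewrite lee_fin (le_trans bw)// ler_norm.
have -> : (fun w : T => `|M|%:E) = cst `|M|%:E by [].
rewrite integral_cst// -ge0_fin_numE ?mule_ge0// fin_numM//.
exact: fin_num_measure.
Qed.

Lemma ae_boundedM_integrable X Z (M : R) : measurable_fun setT X ->
  {ae P, forall w, `|X w| <= M} -> P.-integrable setT (EFin \o Z) ->
  P.-integrable setT (EFin \o (fun w => X w * Z w)).
Proof.
move=> mX bX iZ; have mZ : measurable_fun setT Z.
  by apply/measurable_EFinP; case/integrableP: iZ.
have iMZ : P.-integrable setT (fun w => M%:E * (EFin \o Z) w)%E.
  exact: integrableZl.
have [mMZ fMZ] := integrableP _ _ _ iMZ.
apply/integrableP; split.
  by apply/measurable_EFinP; exact: measurable_funM.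
apply: le_lt_trans fMZ; apply: ae_ge0_le_integral => //.
- apply: measurableT_comp => //; apply/measurable_EFinP; exact: measurable_funM.
- exact: measurableT_comp.
- apply: filterS bX => w bw _; rewrite /= lee_fin !normrM ler_wpM2r//.
  by rewrite (le_trans bw)// ler_norm.
Qed.

Lemma integrable_scale (k : R) Z : P.-integrable setT (EFin \o Z) ->
  P.-integrable setT (EFin \o (fun w => k * Z w)).
Proof.
move=> iZ.
have -> : EFin \o (fun w => k * Z w) = (fun w => k%:E * (EFin \o Z) w)%E.
  by apply/funext => w /=; rewrite EFinM.
exact: integrableZl.
Qed.

Lemma ae_le_mean X Y : P.-integrable setT (EFin \o X) ->
  P.-integrable setT (EFin \o Y) -> {ae P, forall w, X w <= Y w} ->
  \int[P]_w X w <= \int[P]_w Y w.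
Proof.
move=> iX iY XY; rewrite -subr_ge0 -RintegralB//.
have mB : measurable_fun setT (fun w => Y w - X w).
  apply: measurable_funB; apply/measurable_EFinP;
    [by case/integrableP: iY|by case/integrableP: iX].
rewrite /Rintegral (@ae_eq_integral _ _ _ P setT (fun w => `|Y w - X w|%:E) _)//.
- by apply: fine_ge0; exact: integral_ge0.
- exact/measurable_EFinP.
- by apply/measurable_EFinP; exact: measurableT_comp.
- by apply: filterS XY => w h _ /=; rewrite ger0_norm// subr_ge0.
Qed.

Lemma mean_cst (c : R) : \int[P]_(w in setT) c = c.
Proof.
have h : c * fine (P setT) = c by rewrite probability_setT mulr1.
by rewrite Rintegral_cst//; exact: h.
Qed.

Lemma mean_sum (I : Type) (s : seq I) (X : I -> T -> R) :
  (forall i, P.-integrable setT (EFin \o X i)) ->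
  \int[P]_w (\sum_(i <- s) X i w) = \sum_(i <- s) \int[P]_w X i w.
Proof.
move=> iX; elim: s => [|i s IH].
  rewrite big_nil; under eq_Rintegral do rewrite big_nil.
  by rewrite Rintegral_cst// mul0r.
rewrite big_cons -IH; under eq_Rintegral do rewrite big_cons.
rewrite RintegralD//.
rewrite [X in integrable _ _ X](_ : _ = fun w => \sum_(i <- s) (EFin \o X i) w)%E.
  by apply: integrable_sum => // j _; exact: iX.
by apply/funext => w /=; rewrite sumEFin.
Qed.

Lemma mean_indic (B : set T) Z :
  \int[P]_(w in B) Z w = \int[P]_w (\1_B w * Z w).
Proof.
rewrite Rintegral_mkcond; apply: eq_Rintegral => w _.
by rewrite patchE indicE; case: (w \in B); rewrite ?mul1r ?mul0r.
Qed.

End expectation.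

(** * Taking out what is known *)

Section orthogonality.
Context d (T : measurableType d) (R : realType) (P : probability T R).
Variables (G : set (set T)).
Hypotheses (sG : sigma_algebra setT G) (subG : G `<=` measurable).
Implicit Types X Y Z g : T -> R.

Lemma measurable_wrtP g (B : set R) : measurable_wrt G g -> measurable B ->
  G (g @^-1` B).
Proof.
move=> mg mB; have := mg measurableT _ mB.
by rewrite setTI /measurable /= sigma_algebra_id.
Qed.

Lemma measurable_wrt_measurable g : measurable_wrt G g -> measurable_fun setT g.
Proof. by move=> mg _ B mB; rewrite setTI; apply/subG/measurable_wrtP. Qed.

Lemma indic_wrt (B : set T) : G B -> measurable_wrt G (\1_B : T -> R).
Proof.
move=> GB; apply: measurable_indic.
by rewrite /measurable /= sigma_algebra_id.
Qed.

(** The indicator of the set where g >= M / 2 integrates to 0 against Z, so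
    subtracting M / 2 times it from g leaves the integral unchanged and halves
    the bound on g. This binary expansion of g takes the place of a limit of
    simple functions. *)
Lemma halving_bound Z (n : nat) : P.-integrable setT (EFin \o Z) ->
  (forall B, G B -> \int[P]_(w in B) Z w = 0) ->
  forall g (M : R), measurable_wrt G g -> (forall w, 0 <= g w <= M) ->
  `|\int[P]_w (g w * Z w)| <= M * 2 ^- n * \int[P]_w `|Z w|.
Proof.
move=> iZ Z0.
have iaZ : P.-integrable setT (EFin \o (fun w => `|Z w|)).
  exact: (integrable_abse iZ).
elim: n => [|n IH] g M mg gM.
  have iM : P.-integrable setT (EFin \o (fun w => M * `|Z w|)).
    exact: integrable_scale.
  have igZ : P.-integrable setT (EFin \o (fun w => g w * Z w)).
    apply: (@ae_boundedM_integrable _ _ _ _ _ _ M) => //.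
      exact: measurable_wrt_measurable.
    by apply: aeW => w; have /andP[g0 gm] := gM w; rewrite ger0_norm.
  rewrite expr0 invr1 mulr1 (le_trans (le_normr_Rintegral _ _))//.
  rewrite -RintegralZl//; apply: le_Rintegral => //.
    exact: (integrable_abse igZ).
  move=> w _; have /andP[g0 gm] := gM w.
  by rewrite normrM ger0_norm// ler_wpM2r.
pose B := g @^-1` `[M / 2, +oo[%classic.
have GB : G B by apply: measurable_wrtP.
pose h w := g w - M / 2 * \1_B w.
have mh : measurable_wrt G h.
  apply: measurable_funB => //; apply: measurable_funM => //.
  exact: indic_wrt.
have Bw w : (\1_B w : R) = (M / 2 <= g w)%R%:R.
  by rewrite indicE; congr (_%:R); congr nat_of_bool; apply/idP/idP;
    rewrite inE /B /= in_itv /= andbT.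
have hM w : 0 <= h w <= M / 2.
  have /andP[g0 gm] := gM w; rewrite /h Bw.
  by case: (lerP (M / 2) (g w)) => h1 /=; lra.
suff -> : \int[P]_w (g w * Z w) = \int[P]_w (h w * Z w).
  rewrite (le_trans (IH _ _ mh hM))//.
  by rewrite exprS invfM mulrA.
have mB : measurable_fun setT (\1_B : T -> R).
  by apply: measurable_wrt_measurable; exact: indic_wrt.
have iBZ : P.-integrable setT (EFin \o (fun w => \1_B w * Z w)).
  apply: (@ae_boundedM_integrable _ _ _ _ _ _ 1) => //.
  apply: aeW => w; rewrite indicE.
  by case: (w \in B) => /=; rewrite ?normr1 ?normr0.
have -> : \int[P]_w (g w * Z w) =
   \int[P]_w (h w * Z w + M / 2 * (\1_B w * Z w)).
  by apply: eq_Rintegral => w _; rewrite /h; ring.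
rewrite RintegralD//.
- by rewrite RintegralZl// -mean_indic Z0// mulr0 addr0.
- apply: (@ae_boundedM_integrable _ _ _ _ _ _ (M / 2)) => //.
    exact: measurable_wrt_measurable.
  by apply: aeW => w; have /andP[? ?] := hM w; rewrite ger0_norm.
- exact: integrable_scale.
Qed.

Lemma orthogonal_nneg Z g (M : R) : P.-integrable setT (EFin \o Z) ->
  (forall B, G B -> \int[P]_(w in B) Z w = 0) ->
  measurable_wrt G g -> (forall w, 0 <= g w <= M) ->
  \int[P]_w (g w * Z w) = 0.
Proof.
move=> iZ Z0 mg gM; apply/eqP; rewrite -normr_eq0 eq_le normr_ge0 andbT.
pose c := M * \int[P]_w `|Z w|.
have le_c n : `|\int[P]_w (g w * Z w)| <= geometric c 2^-1 n.
  rewrite /geometric /= (le_trans (halving_bound n iZ Z0 mg gM))//.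
  by rewrite /c exprVn mulrAC.
have c0 : geometric c 2^-1 @ \oo --> (0 : R).
  by apply: cvg_geometric; rewrite ger0_norm// invf_lt1// ltr1n.
rewrite -(cvg_lim (@Rhausdorff R) c0); apply: limr_ge.
  by apply/cvg_ex; exists 0.
by apply: nearW => n; exact: le_c.
Qed.

Lemma orthogonal Z g (M : R) : P.-integrable setT (EFin \o Z) ->
  (forall B, G B -> \int[P]_(w in B) Z w = 0) ->
  measurable_wrt G g -> {ae P, forall w, `|g w| <= M} ->
  \int[P]_w (g w * Z w) = 0.
Proof.
move=> iZ Z0 mg gM.
(* Almost everywhere h is g + M', but h lies in [0, 2 M'] everywhere. *)
pose M' := `|M|; pose h w := Num.max 0 (Num.min (g w + M') (2 * M')).
have mh : measurable_wrt G h.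
  apply: measurable_maxr => //; apply: measurable_minr => //.
  exact: measurable_funD.
have M0 : 0 <= M' := normr_ge0 _.
have mZ : measurable_fun setT Z.
  by apply/measurable_EFinP; case/integrableP: iZ.
have hM w : 0 <= h w <= 2 * M'.
  by rewrite /h le_max lexx /= ge_max ge_min lexx orbT andbT mulr_ge0.
have ihZ : P.-integrable setT (EFin \o (fun w => h w * Z w)).
  apply: (@ae_boundedM_integrable _ _ _ _ _ _ (2 * M')) => //.
    exact: measurable_wrt_measurable.
  by apply: aeW => w; have /andP[? ?] := hM w; rewrite ger0_norm.
have iMZ : P.-integrable setT (EFin \o (fun w => M' * Z w)).
  exact: integrable_scale.
have -> : \int[P]_w (g w * Z w) = \int[P]_w (h w * Z w - M' * Z w).
  congr fine; apply: ae_eq_integral => //.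
  - apply/measurable_EFinP; apply: measurable_funM => //.
    exact: measurable_wrt_measurable.
  - apply/measurable_EFinP; apply: measurable_funB; apply: measurable_funM => //.
    exact: measurable_wrt_measurable.
  - apply: filterS gM => w; rewrite ler_norml => /andP[g1 g2] _ /=.
    congr (_%:E); rewrite -mulrBl; congr (_ * _).
    have ? : M <= M' := ler_norm _.
    rewrite /h min_l; last by lra.
    rewrite max_r; last by lra.
    by ring.
rewrite RintegralB// (orthogonal_nneg iZ Z0 mh hM).
rewrite (@orthogonal_nneg Z (fun=> M') M')//; first by rewrite subr0.
  exact: measurable_cst.
by move=> w; rewrite M0 lexx.
Qed.

Lemma cond_expectationM X Y g (M : R) : is_cond_expectation P G X Y ->
  P.-integrable setT (EFin \o X) ->
  measurable_wrt G g -> {ae P, forall w, `|g w| <= M} ->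
  \int[P]_w (g w * X w) = \int[P]_w (g w * Y w).
Proof.
move=> [mY iY XY] iX mg gM; apply/eqP; rewrite -subr_eq0; apply/eqP.
have mg' := measurable_wrt_measurable mg.
have igX := ae_boundedM_integrable mg' gM iX.
have igY := ae_boundedM_integrable mg' gM iY.
rewrite -RintegralB//.
under eq_Rintegral do rewrite -mulrBr.
apply: (orthogonal _ _ mg gM).
  exact: (integrableB measurableT iX iY).
move=> B GB; have mB := subG GB.
rewrite RintegralB//; [|exact: integrableS iX|exact: integrableS iY].
by rewrite /Rintegral XY// subrr.
Qed.

End orthogonality.

(** * The truncated square *)

Section tail_square.
Context (R : realType).
Implicit Types a x y : R.

Definition excess a x : R := Num.max (x - a) 0.

Lemma excess_ge0 a x : 0 <= excess a x.
Proof. by rewrite /excess le_max lexx orbT. Qed.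

Lemma excess_le a x : 0 <= a -> 0 <= x -> excess a x <= x.
Proof. by move=> a0 x0; rewrite /excess ge_max x0 andbT; lra. Qed.

(** The squared excess over a has second derivative at most 2, hence the
    Taylor bound. From x <= a / 2 a step of at most a / 2 does not cross a, so
    both squared excesses vanish and no second-order term is needed. *)
Lemma excess_sqr_le a x y : 0 <= a -> y - x <= a / 2 ->
  excess a y ^+ 2 <= excess a x ^+ 2 + 2 * excess a x * (y - x) +
                     (a / 2 < x)%R%:R * (y - x) ^+ 2.
Proof.
move=> a0 yx; rewrite /excess.
case: (ltrP (a / 2) x) => hx /=; last first.
  by rewrite !max_r; lra.
rewrite mul1r.
have square : (x - a) ^+ 2 + 2 * (x - a) * (y - x) + (y - x) ^+ 2
              = (y - a) ^+ 2 by ring.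
case: (lerP (y - a) 0) => hy; case: (lerP (x - a) 0) => hx'.
- by rewrite expr0n /= mulr0 mul0r !add0r sqr_ge0.
- by rewrite square expr0n /= sqr_ge0.
- rewrite expr0n /= mulr0 mul0r !add0r lerXn2r// ?nnegrE; lra.
- by rewrite square.
Qed.

End tail_square.

(** * One step of the walk, pathwise *)

Section step.
Context (R : realType) (m : nat) (n am ap : R).
Implicit Types x y : 'I_m -> R.

(** On the coordinates of a walk at a given time this is [num_alive]. *)
Definition nalive x : nat := #|[set j : 'I_m | x j != 0]%SET|.

Record state x : Prop := State {
  state_ge0 : forall i, 0 <= x i ;
  state_total : \sum_(i < m) x i = n }.

Record sticky_step x y : Prop := StickyStep {
  step_sticky : forall i, x i = 0 -> y i = 0 ;
  step_increase : forall i, x i < y i ->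
    forall j, j != i -> 0 < x j -> y j < x j ;
  step_decrease : forall i, y i < x i -> am <= x i - y i <= ap }.

Lemma nalive_sum x : (nalive x)%:R = \sum_(j < m) (x j != 0)%:R :> R.
Proof.
rewrite /nalive cardsE -sum1_card natr_sum big_mkcond /=.
by apply: eq_bigr => j _; rewrite unfold_in; case: (x j != 0).
Qed.

Lemma state_le x i : state x -> x i <= n.
Proof.
by case=> x0 <-; rewrite (bigD1 i)//= lerDl sumr_ge0.
Qed.

Lemma state_sqr x : state x -> \sum_(i < m) x i ^+ 2 <= n ^+ 2.
Proof.
move=> sx; have [x0 xn] := sx.
rewrite [n ^+ 2]expr2 -{2}xn mulr_sumr; apply: ler_sum => i _.
by rewrite expr2 ler_wpM2r// state_le.
Qed.

Lemma state_card_gt x (h : R) : state x ->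
  h * \sum_(i < m) (h < x i)%R%:R <= n.
Proof.
case=> x0 <-; rewrite mulr_sumr; apply: ler_sum => i _.
by case: ltrP => /= hx; rewrite ?mulr1 ?mulr0// ltW.
Qed.

Lemma nalive_gt0 x : 0 < n -> state x -> (0 < nalive x)%N.
Proof.
move=> n0 [x0 xn]; rewrite lt0n; apply/eqP => r0; move: n0.
rewrite -xn big1 ?ltxx// => i _; apply/eqP; apply: contra_eqT r0 => xi.
by rewrite -lt0n; apply/card_gt0P; exists i; rewrite inE.
Qed.

Lemma nalive1 x : state x -> nalive x = 1%N ->
  exists2 i, x i = n & forall j, j != i -> x j = 0.
Proof.
move=> [x0 xn] /eqP/cards1P[i xi].
have xj j : j != i -> x j = 0.
  move=> ji; apply/eqP; apply: contraNT ji => xj.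
  by rewrite -finset.in_set1 -xi inE.
by exists i => //; rewrite -xn (bigD1 i)//= big1 ?addr0.
Qed.

Lemma nalive_step x y : sticky_step x y -> (nalive y <= nalive x)%N.
Proof.
move=> [s _ _]; apply/subset_leq_card/fintype.subsetP => i; rewrite !inE.
by apply: contra => /eqP /s ->.
Qed.

Section bounds.
Context (x y : 'I_m -> R).
Hypotheses (am0 : 0 < am) (ap0 : 0 < ap)
  (sx : state x) (sy : state y) (xy : sticky_step x y).

Let r : R := (nalive x)%:R.

(** The total is conserved, so the gain of i is the sum of the r - 1 losses of
    the other survivors. *)
Lemma increase_bounds i : x i < y i ->
  0 <= r - 1 /\ (r - 1) * am <= y i - x i <= (r - 1) * ap.
Proof.
move=> lxy.
have xi : x i != 0.
  by apply/eqP => xi; move: lxy; rewrite (step_sticky xy xi) xi ltxx.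
have rE : r - 1 = \sum_(j < m | j != i) (x j != 0)%:R.
  by rewrite /r nalive_sum (bigD1 i)//= xi addrAC subrr add0r.
have yE : y i - x i = \sum_(j < m | j != i) (x j - y j).
  rewrite sumrB; have := state_total sx; have := state_total sy.
  by rewrite (bigD1 i)//= => <-; rewrite (bigD1 i)//= => h; lra.
have dec j : j != i -> (x j != 0)%:R * am <= x j - y j <= (x j != 0)%:R * ap.
  move=> ji; have [xj|xj] := eqVneq (x j) 0.
    by rewrite (step_sticky xy xj) xj subrr !mul0r lexx.
  rewrite !mul1r; apply: (step_decrease xy).
  by apply: (step_increase xy lxy ji); rewrite lt0r xj (state_ge0 sx).
split; first by rewrite rE sumr_ge0.
rewrite rE yE !mulr_suml; apply/andP.
by split; apply: ler_sum => j /dec /andP[].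
Qed.

Lemma sqr_increase_ge i :
  (r - 1) ^+ 2 * am ^+ 2 * (x i < y i)%R%:R <= (y i - x i) ^+ 2.
Proof.
case: ltrP => [lxy|_] /=; last by rewrite mulr0 sqr_ge0.
have [r0 /andP[h _]] := increase_bounds lxy.
by rewrite mulr1 -exprMn lerXn2r ?nnegrE ?mulr_ge0 ?(ltW am0)// subr_ge0 ltW.
Qed.

(** A lone survivor holds the whole total before and after the step, so it
    cannot move. *)
Lemma nalive_decrease i : y i < x i -> (2 <= nalive x)%N.
Proof.
move=> yx; rewrite ltnNge; apply/negP => r1.
have xi : x i != 0.
  by apply/eqP => xi; move: yx; rewrite (step_sticky xy xi) xi ltxx.
have r1' : nalive x = 1%N.
  apply/eqP; rewrite eqn_leq r1 /=; apply/card_gt0P; exists i.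
  by rewrite inE.
have [k xk xj] := nalive1 sx r1'.
have ik : i = k by apply/eqP; apply: contra_neqT xi => /xj.
have : y i = n.
  rewrite -(state_total sy) (bigD1 i)//= big1 ?addr0// => j.
  by rewrite ik => /xj /(step_sticky xy).
by move=> yn; move: yx; rewrite yn ik xk ltxx.
Qed.

Lemma sqr_increment_le i :
  (y i - x i) ^+ 2 <= (r - 1) ^+ 2 * ap ^+ 2 * (x i < y i)%R%:R
                      + ap ^+ 2 * (2 <= nalive x)%N%:R.
Proof.
case: (ltrgtP (x i) (y i)) => [lxy|lyx|->] /=.
- have [r0 /andP[_ h]] := increase_bounds lxy.
  rewrite mulr1 -exprMn; apply: ler_wpDr.
    by rewrite mulr_ge0 ?sqr_ge0 ?ler0n.
  by rewrite lerXn2r ?nnegrE ?mulr_ge0 ?(ltW ap0)// subr_ge0 ltW.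
- rewrite mulr0 add0r (nalive_decrease lyx) mulr1.
  have /andP[_ h] := step_decrease xy lyx.
  by rewrite -sqrrN opprB lerXn2r ?nnegrE ?(ltW ap0)// subr_ge0 ltW.
- by rewrite subrr expr0n /= mulr0 add0r mulr_ge0 ?sqr_ge0.
Qed.

Lemma increment_le (i : 'I_m) : y i - x i <= m%:R * ap.
Proof.
have m0 : 0 <= (m%:R : R) * ap by rewrite mulr_ge0// ltW.
case: (lerP (y i) (x i)) => h; first by lra.
have [_ /andP[_ h']] := increase_bounds h.
apply: (le_trans h'); rewrite ler_pM2r// /r.
have : (nalive x <= m)%N by rewrite -[leqRHS]card_ord max_card.
by rewrite -(ler_nat R); lra.
Qed.

End bounds.
End step.

(** * Essentially bounded random variables *)

Section essentially_bounded.
Context d (T : measurableType d) (R : realType) (P : probability T R).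
Implicit Types X Y Z : T -> R.

Definition ess_bounded X : Prop := measurable_fun setT X /\
  exists M : R, {ae P, forall w, `|X w| <= M}.

Lemma ess_integrable X : ess_bounded X -> P.-integrable setT (EFin \o X).
Proof. by case=> mX [M bX]; apply: ae_bounded_integrable bX. Qed.

Lemma ess_cst (c : R) : ess_bounded (fun=> c).
Proof. by split=> //; exists `|c|; apply: aeW. Qed.

Lemma essD X Y : ess_bounded X -> ess_bounded Y ->
  ess_bounded (fun w => X w + Y w).
Proof.
move=> [mX [M bX]] [mY [N bY]]; split; first exact: measurable_funD.
exists (M + N); apply: filterS2 bX bY => w hX hY.
by rewrite (le_trans (ler_normD _ _))// lerD.
Qed.

Lemma essM X Y : ess_bounded X -> ess_bounded Y ->
  ess_bounded (fun w => X w * Y w).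
Proof.
move=> [mX [M bX]] [mY [N bY]]; split; first exact: measurable_funM.
exists (M * N); apply: filterS2 bX bY => w hX hY.
by rewrite normrM ler_pM.
Qed.

Lemma essB X Y : ess_bounded X -> ess_bounded Y ->
  ess_bounded (fun w => X w - Y w).
Proof.
move=> [mX [M bX]] [mY [N bY]]; split; first exact: measurable_funB.
exists (M + N); apply: filterS2 bX bY => w hX hY.
by rewrite (le_trans (ler_normB _ _))// lerD.
Qed.

Lemma essX X k : ess_bounded X -> ess_bounded (fun w => X w ^+ k).
Proof.
move=> eX; elim: k => [|k IH].
  have -> : (fun w => X w ^+ 0) = (fun=> 1) by apply/funext => w; rewrite expr0.
  exact: ess_cst.
have -> : (fun w => X w ^+ k.+1) = (fun w => X w * X w ^+ k).
  by apply/funext => w; rewrite exprS.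
exact: essM.
Qed.

Lemma ess_sum (I : Type) (s : seq I) (X : I -> T -> R) :
  (forall i, ess_bounded (X i)) -> ess_bounded (fun w => \sum_(i <- s) X i w).
Proof.
move=> eX; elim: s => [|i s IH].
  have -> : (fun w => \sum_(i <- [::]) X i w) = (fun=> 0).
    by apply/funext => w; rewrite big_nil.
  exact: ess_cst.
have -> : (fun w => \sum_(j <- i :: s) X j w) =
          (fun w => X i w + \sum_(j <- s) X j w).
  by apply/funext => w; rewrite big_cons.
exact: essD.
Qed.

Lemma measurable_natr (f : T -> bool) : measurable_fun setT f ->
  measurable_fun setT (fun w => (f w)%:R : R).
Proof.
move=> mf; have -> : (fun w => (f w)%:R : R) = (fun w => if f w then 1 else 0).
  by apply/funext => w; case: (f w).
exact: measurable_fun_ifT.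
Qed.

Lemma ess_bool (f : T -> bool) : measurable_fun setT f ->
  ess_bounded (fun w => (f w)%:R).
Proof.
move=> mf; split; first exact: measurable_natr.
by exists 1; apply: aeW => w; case: (f w); rewrite ?normr1 ?normr0 ?ler01.
Qed.

(** With an arbitrary phi, expressions such as the inverse or a shifted square
    of a bounded count need no separate treatment. *)
Lemma ess_nat (N : T -> nat) (phi : nat -> R) (m : nat) :
  measurable_fun setT N -> (forall w, (N w <= m)%N) ->
  ess_bounded (fun w => phi (N w)).
Proof.
move=> mN Nm; split; first exact: (@measurableT_comp _ _ _ _ _ _ phi).
exists (\sum_(k < m.+1) `|phi k|); apply: aeW => w.
have lt : (N w < m.+1)%N by rewrite ltnS.
by rewrite (bigD1 (Ordinal lt))//= lerDl sumr_ge0.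
Qed.

End essentially_bounded.

Section nalive_measurable.
Context d (T : measurableType d) (R : realType) (m : nat).

Lemma measurable_nalive (X : 'I_m -> T -> R) :
  (forall i, measurable_fun setT (X i)) ->
  measurable_fun setT (fun w => nalive (fun i => X i w)).
Proof.
move=> mX _ B _; rewrite setTI.
(* The real-valued count is a sum of indicators, and it determines the count. *)
pose Z w : R := \sum_(j < m) (X j w != 0)%:R.
have mZ : measurable_fun setT Z.
  apply: measurable_sum => j; apply: measurable_natr.
  have -> : (fun w => X j w != 0) = (fun w => ~~ (X j w == 0)) by [].
  apply: (@measurableT_comp _ _ _ _ _ _ negb) => //.
  exact: measurable_fun_eqr.
have -> : (fun w => nalive (fun i => X i w)) @^-1` B =
  \bigcup_(k in B) (Z @^-1` [set k%:R]).
  apply/seteqP; split => [w /= Bw|w [k Bk] /=].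
    by exists (nalive (fun i => X i w)) => //=; rewrite nalive_sum.
  rewrite /Z -(nalive_sum (fun i => X i w)) => /eqP.
  by rewrite eqr_nat => /eqP ->.
apply: bigcup_measurable => k _; rewrite -[X in measurable X]setTI.
exact: mZ.
Qed.

End nalive_measurable.

(** * The absorption time as a series *)

Section absorption.
Context (R : realType) (T : Type) (m : nat) (A : 'I_m -> nat -> T -> R).

Definition not_yet (t : nat) : set T :=
  [set w | forall s, (s <= t)%N -> num_alive A s w != 1%N].

(** This holds at every w, also when absorption never happens; it therefore
    gives measurability of the absorption time along with its mean. *)
Lemma absorption_time_series w : absorption_time A w =
  (\sum_(0 <= t <oo) (\1_(not_yet t) w)%:E)%E.
Proof.
have ge0 t : (0 <= (\1_(not_yet t) w : R)%:E)%E by rewrite lee_fin indicE ler0n.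
have [[t0 Nt0 t0_min]|none] :
    (exists2 t0, num_alive A t0 w = 1%N &
       forall t, num_alive A t w = 1%N -> (t0 <= t)%N) \/
    (forall t, num_alive A t w != 1%N).
- have [ex|nex] := pselect (exists t, num_alive A t w == 1%N).
    left; case: (ex_minnP ex) => t0 /eqP ? h; exists t0 => // t /eqP; exact: h.
  by right => t; apply/negP => h; apply: nex; exists t.
- rewrite (@nneseries_split _ _ 0 t0)// add0n.
  rewrite [X in (_ + X)%E]eseries0 ?adde0; last first.
    move=> t t0t _; rewrite indicE memNset//= => /(_ _ t0t).
    by rewrite Nt0 eqxx.
  rewrite (eq_big_nat _ _ (F2 := fun=> 1%E)); last first.
    move=> t /andP[_ tt0]; rewrite indicE mem_set// => s st.
    apply/eqP => /t0_min; rewrite leqNgt => /negP; apply.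
    exact: leq_ltn_trans tt0.
  have -> : (\sum_(0 <= i < t0) 1 = (t0%:R : R)%:E)%E.
    by rewrite sumEFin sumr_const_nat subn0.
  apply/eqP; rewrite eq_le; apply/andP; split.
    by apply: ereal_inf_lbound; exists t0.
  apply: le_ereal_inf_tmp => _ [t /= Nt <-].
  by rewrite lee_fin ler_nat t0_min.
- have -> : absorption_time A w = +oo%E.
    rewrite /absorption_time (_ : [set _ | _ in _] = set0) ?ereal_inf0//.
    apply/seteqP; split => // x [t /= Nt _].
    by have := none t; rewrite Nt eqxx.
  apply/esym/eqyP => M M0.
  apply: le_trans (nneseries_lim_ge (Num.bound M) _); last by [].
  rewrite (eq_bigr (fun=> 1%E)); last first.
    by move=> t _; rewrite indicE mem_set//.
  rewrite sumEFin sumr_const_nat subn0 lee_fin ltW//.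
  exact/archi_boundP/ltW.
Qed.

End absorption.

(** * Drift of the potentials *)

Section walk.
Context (R : realType) (d : measure_display) (T : measurableType d)
  (P : probability T R) (F : nat -> set (set T)) (m : nat)
  (n : R) (pminus pplus : nat -> R) (am ap k K : R)
  (A : 'I_m -> nat -> T -> R).
Hypotheses (am0 : 0 < am) (ap0 : 0 < ap) (n0 : 0 < n) (k0 : 0 < k) (K0 : 0 < K)
  (hpm : forall r : nat, (0 < r)%N -> k / r%:R <= pminus r)
  (hpp : forall r : nat, (0 < r)%N -> `|pplus r| <= K / r%:R)
  (walk : sticky_random_walk P F n pminus pplus am ap A).

Definition conf t w : 'I_m -> R := fun i => A i t w.

Let N t w := nalive (conf t w).

(** Countably many almost sure conditions, gathered so that a single exceptional
    null set remains and the pathwise lemmas apply at all times. *)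
Lemma walk_regular : {ae P, forall w, forall t,
  state n (conf t w) /\ sticky_step am ap (conf t w) (conf t.+1 w)}.
Proof.
apply: ae_foralln => t.
have h1 : {ae P, forall w, forall i, 0 <= A i t w}.
  by apply: filter_forall => i; exact: srw_ge0 walk i t.
have h2 : {ae P, forall w, forall i, A i t w = 0 -> A i t.+1 w = 0}.
  by apply: filter_forall => i; exact: srw_sticky walk i t.
have h3 : {ae P, forall w, forall i, A i t w < A i t.+1 w ->
      forall j, j != i -> 0 < A j t w -> A j t.+1 w < A j t w}.
  by apply: filter_forall => i; exact: srw_increase walk i t.
have h4 : {ae P, forall w, forall i, A i t.+1 w < A i t w ->
      am <= A i t w - A i t.+1 w <= ap}.
  by apply: filter_forall => i; exact: srw_decrease walk i t.
have h5 := srw_total walk t.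
by apply: filterS2 (filterI h1 h2) (filterI h3 (filterI h4 h5))
  => w [? ?] [? [? ?]]; split; split.
Qed.

Lemma walk_sigma t : sigma_algebra setT (F t).
Proof. by have [] := srw_filtration walk. Qed.

Lemma walk_sub t : F t `<=` measurable.
Proof. by have [] := srw_filtration walk. Qed.

Lemma adapted i t : measurable_wrt (F t) (A i t).
Proof. by have [] := srw_martingale walk i. Qed.

Lemma adapted_measurable t (g : T -> R) :
  measurable_wrt (F t) g -> measurable_fun setT g.
Proof.
by apply: measurable_wrt_measurable; [exact: walk_sigma|exact: walk_sub].
Qed.

Lemma adapted_nalive t (phi : nat -> R) :
  measurable_wrt (F t) (fun w => phi (N t w)).
Proof.
apply: (@measurableT_comp _ _ _ _ _ _ phi) => //.
by apply: measurable_nalive => i; exact: adapted.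
Qed.

Lemma adapted_ltr i t (c : R) :
  measurable_wrt (F t) (fun w => (c < A i t w)%R%:R : R).
Proof.
apply: (@measurable_natr _ (g_sigma_algebraType (F t)) R).
by apply: measurable_fun_ltr => //; exact: adapted.
Qed.

Lemma ess_walk i t : ess_bounded P (A i t).
Proof.
split; first exact: (adapted_measurable (@adapted i t)).
exists n; apply: filterS walk_regular => w /(_ t)[sx _].
by rewrite ger0_norm ?(state_ge0 sx)// (state_le i sx).
Qed.

Lemma ess_nalive t (phi : nat -> R) : ess_bounded P (fun w => phi (N t w)).
Proof.
apply: (@ess_nat _ _ _ _ _ _ m).
  by apply: measurable_nalive => i; exact: (ess_walk i t).1.
by move=> w; rewrite -[leqRHS]card_ord max_card.
Qed.

Lemma ess_ltr i t (c : R) : ess_bounded P (fun w => (c < A i t w)%R%:R : R).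
Proof.
by apply: ess_bool; apply: measurable_fun_ltr => //; exact: (ess_walk i t).1.
Qed.

Let inc i t w : R := (A i t w < A i t.+1 w)%R%:R.

Lemma ess_increase i t : ess_bounded P (inc i t).
Proof.
apply: ess_bool; apply: measurable_fun_ltr;
  [exact: (ess_walk i t).1|exact: (ess_walk i t.+1).1].
Qed.

Lemma martingale_orthogonal i t (g : T -> R) : measurable_wrt (F t) g ->
  ess_bounded P g -> \int[P]_w (g w * (A i t.+1 w - A i t w)) = 0.
Proof.
move=> mg eg; have [_ [M bg]] := eg.
have [_ _ ce] := srw_martingale walk i.
under eq_Rintegral do rewrite mulrBr.
rewrite RintegralB//; try by apply/ess_integrable/essM => //; exact: ess_walk.
apply/eqP; rewrite subr_eq0; apply/eqP.
apply: (cond_expectationM (walk_sigma t) (@walk_sub t) (ce t) _ mg bg).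
exact/ess_integrable/ess_walk.
Qed.

(** The bounds on the conditional probability of an increase, integrated against
    a weight g known at time t. The support condition on g restricts it to the
    event where these bounds are assumed. *)
Lemma prob_increase_bounds i t (g : T -> R) : measurable_wrt (F t) g ->
  ess_bounded P g -> {ae P, forall w, 0 <= g w} ->
  {ae P, forall w, g w != 0 -> (2 <= N t w)%N /\ 0 < A i t w} ->
  k * (\int[P]_w (g w / (N t w)%:R)) <= \int[P]_w (g w * inc i t w)
    <= K * (\int[P]_w (g w / (N t w)%:R)).
Proof.
move=> mg eg g0 gs; have [m_g [M bg]] := eg.
have [Y cY bY] := srw_prob_increase walk i t.
have incE : \1_[set w | A i t w < A i t.+1 w] = inc i t.
  by apply/funext => w; rewrite indicE /inc; congr (_%:R); congr nat_of_bool;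
    apply/idP/idP; rewrite inE.
have -> : \int[P]_w (g w * inc i t w) = \int[P]_w (g w * Y w).
  rewrite -incE.
  apply: (cond_expectationM (walk_sigma t) (@walk_sub t) cY _ mg bg).
  by rewrite incE; exact/ess_integrable/ess_increase.
have igY : P.-integrable setT (EFin \o (fun w => g w * Y w)).
  by apply: ae_boundedM_integrable m_g bg _; case: cY.
have ir : ess_bounded P (fun w => g w / (N t w)%:R).
  by apply: essM => //; exact: (@ess_nalive t (fun r => r%:R^-1)).
have H : {ae P, forall w, k * (g w / (N t w)%:R) <= g w * Y w
                          <= K * (g w / (N t w)%:R)}.
  apply: filterS2 (filterI g0 gs) bY => w [gw0 gws] Yw.
  have [->|gn0] := eqVneq (g w) 0; first by rewrite !mul0r !mulr0 lexx.
  have [N2 Ai] := gws gn0.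
  have /andP[Y1 Y2] := Yw N2 Ai.
  have N0 : (0 < N t w)%N by exact: leq_trans N2.
  rewrite !(mulrCA _ (g w)) !ler_wpM2l//.
    by rewrite (le_trans Y2)// (le_trans (ler_norm _))// hpp.
  by rewrite (le_trans _ Y1)// hpm.
rewrite -!RintegralZl//; try exact: ess_integrable.
apply/andP; split; apply: ae_le_mean => //;
  try by apply/ess_integrable/essM => //; exact: ess_cst.
- by apply: filterS H => w /andP[].
- by apply: filterS H => w /andP[].
Qed.

Let D i t w : R := A i t.+1 w - A i t w.

Lemma ess_increment i t : ess_bounded P (D i t).
Proof. by apply: essB; exact: ess_walk. Qed.

(** The cross term vanishes: increments are orthogonal to the past. *)
Lemma mean_sqr_step i t :
  \int[P]_w (A i t.+1 w ^+ 2) =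
  \int[P]_w (A i t w ^+ 2) + \int[P]_w (D i t w ^+ 2).
Proof.
have e1 := ess_walk i t; have e2 := ess_increment i t.
have -> : \int[P]_w (A i t.+1 w ^+ 2) =
  \int[P]_w (A i t w ^+ 2 + D i t w ^+ 2 + 2 * (A i t w * D i t w)).
  by apply: eq_Rintegral => w _; rewrite /D; ring.
rewrite RintegralD//; first last.
- by apply: ess_integrable; apply: essM; [exact: ess_cst|exact: essM].
- by apply: ess_integrable; apply: essD; exact: essX.
rewrite RintegralD//; try exact/ess_integrable/essX.
rewrite RintegralZl//; last exact/ess_integrable/essM.
by rewrite (martingale_orthogonal i (@adapted i t) e1) mulr0 addr0.
Qed.

Lemma mean_increase_sqr_le i t :
  am ^+ 2 * \int[P]_w (((N t w)%:R - 1) ^+ 2 * (0 < A i t w)%R%:R * inc i t w)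
  <= \int[P]_w (D i t w ^+ 2).
Proof.
have eg : ess_bounded P
    (fun w => ((N t w)%:R - 1) ^+ 2 * (0 < A i t w)%R%:R * inc i t w).
  apply: essM; last exact: ess_increase.
  apply: essM; last exact: ess_ltr.
  exact: (@ess_nalive t (fun r => (r%:R - 1) ^+ 2)).
rewrite -RintegralZl//; last exact: ess_integrable.
apply: ae_le_mean.
- by apply/ess_integrable/essM => //; exact: ess_cst.
- exact/ess_integrable/essX/ess_increment.
- apply: filterS walk_regular => w reg.
  have [[sx xy] [sy _]] := (reg t, reg t.+1).
  apply: le_trans (sqr_increase_ge am0 sx sy xy i).
  rewrite mulrA [_ * am ^+ 2]mulrC; apply: ler_wpM2r; first exact: ler0n.
  rewrite -[leRHS]mulr1 mulrA; apply: ler_wpM2l; last by rewrite lern1 leq_b1.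
  by rewrite mulr_ge0 ?sqr_ge0.
Qed.

(** Each of the r survivors gains at least (r - 1) am with probability at least
    k / r. The factor (r - 1)^2 vanishes at r = 1, where no bound on the
    probability of an increase is available. *)
Lemma drift_square t :
  k * am ^+ 2 * \int[P]_w (((N t w)%:R - 1) ^+ 2) <=
  \int[P]_w (\sum_(i < m) A i t.+1 w ^+ 2) -
  \int[P]_w (\sum_(i < m) A i t w ^+ 2).
Proof.
have eA i s : P.-integrable setT (EFin \o (fun w => A i s w ^+ 2)).
  exact/ess_integrable/essX/ess_walk.
rewrite !mean_sum// -sumrB.
pose g i w : R := ((N t w)%:R - 1) ^+ 2 * (0 < A i t w)%R%:R.
have mg i : measurable_wrt (F t) (g i).
  apply: measurable_funM; last exact: adapted_ltr.
  exact: (@adapted_nalive t (fun r => (r%:R - 1) ^+ 2)).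
have eg i : ess_bounded P (g i).
  apply: essM; last exact: ess_ltr.
  exact: (@ess_nalive t (fun r => (r%:R - 1) ^+ 2)).
have eN : ess_bounded P (fun w => (N t w)%:R^-1).
  exact: (@ess_nalive t (fun r => r%:R^-1)).
have -> : \int[P]_w (((N t w)%:R - 1) ^+ 2) =
          \int[P]_w (\sum_(i < m) g i w / (N t w)%:R).
  congr fine; apply: ae_eq_integral => //.
  - apply/measurable_EFinP.
    exact: (@ess_nalive t (fun r => (r%:R - 1) ^+ 2)).1.
  - by apply/measurable_EFinP; apply: (ess_sum _ _).1 => i; exact: essM.
  - apply: filterS walk_regular => w /(_ t)[sx _] _ /=; congr (_%:E).
    have N0 : (N t w)%:R != 0 :> R.
      by rewrite pnatr_eq0 -lt0n (nalive_gt0 n0 sx).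
    rewrite -mulr_suml -mulr_sumr.
    rewrite (_ : \sum_(i < m) _ = (N t w)%:R); first by rewrite mulfK.
    rewrite /N nalive_sum; apply: eq_bigr => i _.
    by rewrite lt0r (state_ge0 sx) andbT.
rewrite mean_sum; last by move=> i; exact/ess_integrable/essM.
rewrite mulr_sumr; apply: ler_sum => i _.
rewrite mean_sqr_step addrAC subrr add0r.
apply: le_trans (mean_increase_sqr_le i t).
rewrite [k * _]mulrC -mulrA; apply: ler_wpM2l; first exact: sqr_ge0.
have g0 : {ae P, forall w, 0 <= g i w}.
  by apply: aeW => w; rewrite mulr_ge0 ?sqr_ge0.
have gs : {ae P, forall w, g i w != 0 -> (2 <= N t w)%N /\ 0 < A i t w}.
  apply: filterS walk_regular => w /(_ t)[sx _].
  rewrite /g mulf_eq0 negb_or sqrf_eq0 subr_eq0 pnatr_eq0.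
  case: ltrP => [Ai|_]; rewrite ?eqxx ?andbF// => /andP[N1 _]; split => //.
  by rewrite ltn_neqAle eq_sym -(eqr_nat R) N1 (nalive_gt0 n0 sx).
by have /andP[] := prob_increase_bounds (mg i) (eg i) g0 gs.
Qed.

Lemma adapted_excess (h : R) t i :
  measurable_wrt (F t) (fun w => excess h (A i t w)).
Proof.
apply: measurable_maxr => //; apply: measurable_funB => //; exact: adapted.
Qed.

Lemma ess_excess (h : R) t i : 0 <= h ->
  ess_bounded P (fun w => excess h (A i t w)).
Proof.
move=> h0; split; first exact: (adapted_measurable (@adapted_excess h t i)).
exists n; apply: filterS walk_regular => w /(_ t)[sx _].
rewrite ger0_norm ?excess_ge0// (le_trans _ (state_le i sx))//.
by rewrite excess_le// (state_ge0 sx).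
Qed.

Lemma mean_excess_step (h : R) i t : 0 <= h -> m%:R * ap <= h / 2 ->
  \int[P]_w (excess h (A i t.+1 w) ^+ 2) <=
  \int[P]_w (excess h (A i t w) ^+ 2) +
  \int[P]_w ((h / 2 < A i t w)%R%:R * D i t w ^+ 2).
Proof.
move=> h0 mh.
have e1 s := ess_excess s i h0; have e2 := ess_increment i t.
have e3 : ess_bounded P (fun w => (h / 2 < A i t w)%R%:R * D i t w ^+ 2).
  by apply: essM; [exact: ess_ltr|exact: essX].
have e4 : ess_bounded P (fun w => 2 * (excess h (A i t w) * D i t w)).
  by apply: essM; [exact: ess_cst|exact: essM].
have <- : \int[P]_w (excess h (A i t w) ^+ 2 +
            2 * (excess h (A i t w) * D i t w) +
            (h / 2 < A i t w)%R%:R * D i t w ^+ 2) =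
  \int[P]_w (excess h (A i t w) ^+ 2) +
  \int[P]_w ((h / 2 < A i t w)%R%:R * D i t w ^+ 2).
  rewrite RintegralD//;
    try by apply: ess_integrable => //; apply: essD => //; exact: essX.
  rewrite RintegralD//; try by apply: ess_integrable => //; exact: essX.
  rewrite RintegralZl//; last exact/ess_integrable/essM.
  rewrite (martingale_orthogonal i (@adapted_excess h t i) (e1 t)).
  by rewrite mulr0 addr0.
apply: ae_le_mean.
- exact/ess_integrable/essX.
- by apply: ess_integrable; apply: essD => //; apply: essD => //; exact: essX.
- apply: filterS walk_regular => w reg.
  have [[sx xy] [sy _]] := (reg t, reg t.+1).
  rewrite mulrA; apply: excess_sqr_le => //.
  exact: le_trans (increment_le ap0 sx sy xy i) mh.
Qed.

(** The second moment of an increment is at most linear in r: a jump of size at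
    most (r - 1) ap occurs with probability at most K / r, and the decreases
    contribute at most ap^2. The weight keeps track of the large coordinates,
    which are few. *)
Lemma mean_large_sqr_le (h : R) i t : 0 <= h ->
  \int[P]_w ((h < A i t w)%R%:R * D i t w ^+ 2) <= ap ^+ 2 *
  \int[P]_w ((h < A i t w)%R%:R *
             (K * ((N t w)%:R - 1) + (2 <= N t w)%N%:R)).
Proof.
move=> h0.
pose b w : R := (h < A i t w)%R%:R.
pose g w : R := ((N t w)%:R - 1) ^+ 2 * b w.
pose two w : R := (2 <= N t w)%N%:R.
have eb : ess_bounded P b by exact: ess_ltr.
have b0 w : 0 <= b w by exact: ler0n.
have e2 : ess_bounded P two by exact: (@ess_nalive t (fun r => (2 <= r)%N%:R)).
have eN : ess_bounded P (fun w => (N t w)%:R^-1).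
  exact: (@ess_nalive t (fun r => r%:R^-1)).
have eN1 : ess_bounded P (fun w => (N t w)%:R - 1).
  exact: (@ess_nalive t (fun r => r%:R - 1)).
have eg : ess_bounded P g by apply: essM => //; exact: essX.
have ei := ess_increase i t.
have mg : measurable_wrt (F t) g.
  apply: measurable_funM; last exact: adapted_ltr.
  exact: (@adapted_nalive t (fun r => (r%:R - 1) ^+ 2)).
have g0 : {ae P, forall w, 0 <= g w}.
  by apply: aeW => w; rewrite mulr_ge0 ?sqr_ge0.
have gs : {ae P, forall w, g w != 0 -> (2 <= N t w)%N /\ 0 < A i t w}.
  apply: filterS walk_regular => w /(_ t)[sx _].
  rewrite /g /b mulf_eq0 negb_or sqrf_eq0 subr_eq0 pnatr_eq0.
  case: ltrP => [Ai|_]; rewrite ?eqxx ?andbF// => /andP[N1 _]; split => //.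
    by rewrite ltn_neqAle eq_sym -(eqr_nat R) N1 (nalive_gt0 n0 sx).
  exact: le_lt_trans Ai.
have /andP[_ gK] := prob_increase_bounds mg eg g0 gs.
apply: (@le_trans _ _ (ap ^+ 2 * (\int[P]_w (g w * inc i t w) +
                                  \int[P]_w (b w * two w)))).
  rewrite -RintegralD//; try exact/ess_integrable/essM.
  rewrite -RintegralZl//;
    last by apply: ess_integrable; apply: essD; exact: essM.
  apply: ae_le_mean.
  - apply: ess_integrable; apply: essM; first exact: ess_ltr.
    exact: essX (ess_increment _ _).
  - apply: ess_integrable; apply: essM; first exact: ess_cst.
    by apply: essD; exact: essM.
  - apply: filterS walk_regular => w reg.
    have [[sx xy] [sy _]] := (reg t, reg t.+1).
    have := sqr_increment_le ap0 sx sy xy i.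
    move=> /(ler_wpM2l (b0 w)) /le_trans; apply.
    by rewrite /g /inc /two /N /conf le_eqVlt; apply/orP; left; apply/eqP; ring.
apply: ler_wpM2l; first exact: sqr_ge0.
apply: (@le_trans _ _ (K * \int[P]_w (g w / (N t w)%:R) +
                       \int[P]_w (b w * two w))).
  by rewrite lerD2r.
rewrite -RintegralZl//; last exact/ess_integrable/essM.
have eKg : ess_bounded P (fun w => K * (g w / (N t w)%:R)).
  by apply: essM; [exact: ess_cst|exact: essM].
rewrite -RintegralD//; first last.
- exact/ess_integrable/essM.
- exact: ess_integrable.
apply: ae_le_mean.
- by apply: ess_integrable; apply: essD => //; exact: essM.
- apply: ess_integrable; apply: essM => //; apply: essD => //.
  by apply: essM => //; exact: ess_cst.
- apply: filterS walk_regular => w /(_ t)[sx _].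
  rewrite -/(b w) -/(two w) mulrDr lerD2r [leRHS]mulrCA ler_pM2l// /g.
  have N1 : 1 <= (N t w)%:R :> R by rewrite ler1n (nalive_gt0 n0 sx).
  have N0 : 0 < (N t w)%:R :> R by exact: lt_le_trans N1.
  rewrite ler_pdivrMr// -[leRHS]mulrA [leLHS]mulrC; apply: ler_wpM2l => //.
  by rewrite expr2 ler_wpM2l// ?subr_ge0// gerBl.
Qed.

(** The total is n, so at most 2 n / h coordinates exceed h / 2, and only these
    contribute. This makes the drift linear in r, in contrast with the quadratic
    growth in [drift_square]. *)
Lemma drift_excess (h : R) t : 0 < h -> m%:R * ap <= h / 2 ->
  \int[P]_w (\sum_(i < m) excess h (A i t.+1 w) ^+ 2) -
  \int[P]_w (\sum_(i < m) excess h (A i t w) ^+ 2) <=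
  2 * n / h * ap ^+ 2 *
  \int[P]_w (K * ((N t w)%:R - 1) + (2 <= N t w)%N%:R).
Proof.
move=> h0 mh.
have h20 : 0 < h / 2 by rewrite divr_gt0.
have eX i s : P.-integrable setT (EFin \o (fun w => excess h (A i s w) ^+ 2)).
  exact/ess_integrable/essX/ess_excess/ltW.
pose W w : R := K * ((N t w)%:R - 1) + (2 <= N t w)%N%:R.
have eW : ess_bounded P W.
  exact: (@ess_nalive t (fun r => K * (r%:R - 1) + (2 <= r)%N%:R)).
have ebW i : ess_bounded P (fun w => (h / 2 < A i t w)%R%:R * W w).
  by apply: essM => //; exact: ess_ltr.
rewrite !mean_sum// -sumrB.
apply: (@le_trans _ _ (ap ^+ 2 *
    \int[P]_w (\sum_(i < m) (h / 2 < A i t w)%R%:R * W w))).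
  rewrite mean_sum; last by move=> i; exact/ess_integrable/ebW.
  rewrite mulr_sumr; apply: ler_sum => i _.
  rewrite lerBlDl (le_trans (mean_excess_step i t (ltW h0) mh))// lerD2l.
  exact/mean_large_sqr_le/ltW.
rewrite [leRHS]mulrAC [leRHS]mulrC; apply: ler_wpM2l; first exact: sqr_ge0.
rewrite -RintegralZl//; last exact: ess_integrable.
apply: ae_le_mean.
- exact/ess_integrable/ess_sum.
- by apply/ess_integrable/essM => //; exact: ess_cst.
- apply: filterS walk_regular => w /(_ t)[sx _].
  rewrite -mulr_suml; apply: ler_wpM2r.
    rewrite addr_ge0// mulr_ge0 ?(ltW K0)// subr_ge0 ler1n.
    exact: nalive_gt0 n0 sx.
  rewrite ler_pdivlMr// mulrC.
  have := state_card_gt (h / 2) sx; rewrite /conf; lra.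
Qed.

Definition unabsorbed t : R := \int[P]_w ((2 <= N t w)%N%:R).

Lemma unabsorbed_le_square t :
  unabsorbed t <= \int[P]_w (((N t w)%:R - 1) ^+ 2).
Proof.
apply: ae_le_mean.
- exact/ess_integrable/(@ess_nalive t (fun r => (2 <= r)%N%:R)).
- exact/ess_integrable/(@ess_nalive t (fun r => (r%:R - 1) ^+ 2)).
- apply: aeW => w; case: (leqP 2 (N t w)) => /= [N2|_]; last by rewrite sqr_ge0.
  have : 2 <= (N t w)%:R :> R by rewrite ler_nat.
  by move=> ?; nra.
Qed.

(** With u = r - 1, the left-hand side integrates L K u - c1 u^2 plus L on the
    event that r >= 2; completing the square bounds it there, and at u = 0 it
    vanishes. *)
Lemma linear_minus_square_le t (L c1 : R) : 0 <= L -> 0 < c1 ->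
  L * \int[P]_w (K * ((N t w)%:R - 1) + (2 <= N t w)%N%:R) -
  c1 * \int[P]_w (((N t w)%:R - 1) ^+ 2) <=
  (L + (L * K) ^+ 2 / (4 * c1)) * unabsorbed t.
Proof.
move=> L0 c10.
have i1 := ess_integrable
  (@ess_nalive t (fun r => K * (r%:R - 1) + (2 <= r)%N%:R)).
have i2 := ess_integrable (@ess_nalive t (fun r => (r%:R - 1) ^+ 2)).
have i3 := ess_integrable (@ess_nalive t (fun r => (2 <= r)%N%:R)).
rewrite -!RintegralZl// -RintegralB//; try exact: integrable_scale.
apply: ae_le_mean; last first.
- apply: filterS walk_regular => w /(_ t)[sx _].
  have N1 : 1 <= (N t w)%:R :> R by rewrite ler1n (nalive_gt0 n0 sx).
  set u := _ - 1; have u0 : 0 <= u by rewrite subr_ge0.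
  case: (leqP 2 (N t w)) => /= [N2|N2]; last first.
    have : (N t w)%:R <= 1 :> R by rewrite lern1 -ltnS.
    move=> ?; have -> : u = 0 by rewrite /u; lra.
    by rewrite expr0n /= !(mulr0, addr0) subr0.
  rewrite mulr1 mulrDr mulr1 addrAC [leRHS]addrC lerD2r ler_pdivlMr ?mulr_gt0//.
  have := sqr_ge0 (L * K - 2 * c1 * u); nra.
- exact: integrable_scale.
- exact: (@ess_integrable _ _ _ P _ (@ess_nalive t (fun r =>
     L * (K * (r%:R - 1) + (2 <= r)%N%:R) - c1 * (r%:R - 1) ^+ 2))).
Qed.

(** * Bounds on the mean absorption time *)

Let q t := unabsorbed t.

Lemma unabsorbed_ge0 t : 0 <= q t.
Proof. by apply: Rintegral_ge0 => w _; exact: ler0n. Qed.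

Lemma measurable_not_yet t : measurable (not_yet A t).
Proof.
have -> : not_yet A t =
    \bigcap_(s in [set s | (s <= t)%N])
      ((fun w => num_alive A s w) @^-1` [set~ 1%N]).
  by apply/seteqP; split => w h s /= /h; [move/eqP|move=> /eqP].
apply: bigcap_measurableType => s _; rewrite -[X in measurable X]setTI.
suff : measurable_fun setT (fun w => num_alive A s w) by apply.
by apply: measurable_nalive => i; exact: (ess_walk i s).1.
Qed.

Lemma mean_not_yet t : (\int[P]_w (\1_(not_yet A t) w)%:E = (q t)%:E)%E.
Proof.
have e2 : ess_bounded P (fun w => (2 <= N t w)%N%:R).
  exact: (@ess_nalive t (fun r => (2 <= r)%N%:R)).
have -> : (q t)%:E = (\int[P]_w ((2 <= N t w)%N%:R : R)%:E)%E.
  by rewrite fineK//; apply: integrable_fin_num => //; exact: ess_integrable.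
apply: ae_eq_integral => //.
- by apply/measurable_EFinP; apply: measurable_indic; exact: measurable_not_yet.
- by apply/measurable_EFinP; exact: e2.1.
- apply: filterS walk_regular => w reg _.
  congr (_%:E); rewrite indicE; congr (_%:R); congr nat_of_bool.
  have gt0 s : (0 < N s w)%N by apply: nalive_gt0 n0 _; exact: (reg s).1.
  apply/idP/idP.
    rewrite inE => /(_ t (leqnn t)) Nt.
    by rewrite ltn_neqAle eq_sym Nt gt0.
  move=> N2; apply/mem_set => s st.
  have mono : {homo N ^~ w : a b / (a <= b)%N >-> (b <= a)%N}.
    apply: homo_leq => [//|a b c ab bc|a]; first exact: leq_trans bc ab.
    by have [_ /nalive_step] := reg a.
  by rewrite neq_ltn (leq_trans N2 (mono _ _ st)) orbT.
Qed.

Lemma mean_absorption_time_series :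
  (\int[P]_w absorption_time A w = \sum_(0 <= t <oo) (q t)%:E)%E.
Proof.
under eq_integral do rewrite absorption_time_series.
rewrite integral_nneseries//.
- by apply: eq_eseriesr => t _; exact: mean_not_yet.
- move=> t; apply/measurable_EFinP; apply: measurable_indic.
  exact: measurable_not_yet.
Qed.

Let S t := \int[P]_w (\sum_(i < m) A i t w ^+ 2).

Lemma mean_square_ge0 t : 0 <= S t.
Proof.
by apply: Rintegral_ge0 => w _; rewrite sumr_ge0// => i _; exact: sqr_ge0.
Qed.

Lemma mean_square_le t : S t <= n ^+ 2.
Proof.
have <- : \int[P]_(w in setT) (n ^+ 2) = n ^+ 2.
  exact: mean_cst.
apply: ae_le_mean.
- by apply/ess_integrable/ess_sum => i; exact/essX/ess_walk.
- exact/ess_integrable/ess_cst.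
- by apply: filterS walk_regular => w /(_ t)[sx _]; exact: state_sqr sx.
Qed.

Lemma sum_unabsorbed_le t : k * am ^+ 2 * (\sum_(0 <= s < t) q s) <= n ^+ 2.
Proof.
apply: (@le_trans _ _ (S t - S 0%N)); last first.
  by rewrite lerBlDr (le_trans (mean_square_le t))// lerDl mean_square_ge0.
rewrite -(telescope_sumr _ (leq0n t)) mulr_sumr; apply: ler_sum => s _.
apply: le_trans (drift_square s).
apply: ler_wpM2l; first by rewrite mulr_ge0 ?sqr_ge0 ?ltW.
exact: unabsorbed_le_square.
Qed.

Lemma mean_absorption_time_le :
  (\int[P]_w absorption_time A w <= ((k * am ^+ 2)^-1 * n ^+ 2)%:E)%E.
Proof.
rewrite mean_absorption_time_series.
apply: lime_le.
  by apply: is_cvg_nneseries => t _ _; rewrite lee_fin unabsorbed_ge0.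
apply: nearW => t; rewrite sumEFin lee_fin mulrC ler_pdivlMr.
  by rewrite mulrC sum_unabsorbed_le.
by rewrite mulr_gt0 ?exprn_gt0.
Qed.

(** The partial sums of the probabilities are bounded by [sum_unabsorbed_le], so
    they cannot all exceed e. Stopping at a time where absorption is likely
    avoids a limit in the lower bound. *)
Lemma unabsorbed_small (e : R) : 0 < e -> exists t, q t <= e.
Proof.
move=> e0; apply/not_existsP => none.
have c0 : 0 < k * am ^+ 2 by rewrite mulr_gt0 ?exprn_gt0.
pose M := n ^+ 2 / (k * am ^+ 2 * e).
have M0 : 0 <= M by rewrite divr_ge0 ?sqr_ge0// mulr_ge0 ?ltW.
have := archi_boundP M0; rewrite /M ltr_pdivrMr ?mulr_gt0//.
apply/negP; rewrite -leNgt; apply: le_trans (sum_unabsorbed_le (Num.bound M)).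
rewrite mulrCA; apply: ler_wpM2l; first exact: ltW.
rewrite [leLHS]mulr_natl -[X in e *+ X]subn0 -sumr_const_nat.
by apply: ler_sum => t _; rewrite ltW// ltNge; apply/negP/none.
Qed.

(** The constant of [linear_minus_square_le] for the potential V - e S, where V
    is taken at level e n and S is the sum of squares. *)
Definition drift_bound (e : R) : R :=
  let L := 2 / e * ap ^+ 2 in L + (L * K) ^+ 2 / (4 * (e * (k * am ^+ 2))).

(** Between time 0 and a time t at which the walk is still unabsorbed with
    probability at most e, the mean of V - e S grows by at least
    ((1 - e)^3 - e - alpha) n^2, and (1 - e)^3 >= 1 - 3 e. *)
Lemma mean_absorption_time_ge (alpha e : R) :
  0 < e -> e <= 1 -> 4 * e <= 1 - alpha -> m%:R * ap <= e * n / 2 ->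
  (forall i, {ae P, forall w, A i 0%N w <= alpha * n}) ->
  (((1 - alpha - 4 * e) / drift_bound e * n ^+ 2)%:E <=
   \int[P]_w absorption_time A w)%E.
Proof.
move=> e0 e1 ea me start.
pose L := 2 / e * ap ^+ 2; set D' := drift_bound e.
have c0 : 0 < k * am ^+ 2 by rewrite mulr_gt0 ?exprn_gt0.
have L0 : 0 < L by rewrite mulr_gt0 ?exprn_gt0 ?divr_gt0.
have D0 : 0 < D'.
  by rewrite ltr_wpDr// divr_ge0 ?sqr_ge0// mulr_ge0// mulr_ge0// ltW.
have en0 : 0 < e * n by rewrite mulr_gt0.
pose V t := \int[P]_w (\sum_(i < m) excess (e * n) (A i t w) ^+ 2).
have eV t : ess_bounded P (fun w => \sum_(i < m) excess (e * n) (A i t w) ^+ 2).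
  by apply: ess_sum => i; exact/essX/(ess_excess _ _ (ltW en0)).
have [t qt] := unabsorbed_small e0.
have drift : V t - V 0%N - e * (S t - S 0%N) <= D' * \sum_(0 <= s < t) q s.
  rewrite -!(telescope_sumr _ (leq0n t)) !mulr_sumr -sumrB.
  apply: ler_sum => s _.
  apply: le_trans (linear_minus_square_le s (ltW L0) (mulr_gt0 e0 c0)).
  apply: lerB; last first.
    rewrite -mulrA; apply: ler_wpM2l; first exact: ltW.
    exact: drift_square.
  have -> : L = 2 * n / (e * n) * ap ^+ 2.
    by rewrite /L; field; rewrite !gt_eqF.
  exact: drift_excess.
have V0 : V 0%N <= alpha * n ^+ 2.
  have <- : \int[P]_(w in setT) (alpha * n ^+ 2) = alpha * n ^+ 2.
    exact: mean_cst.
  apply: ae_le_mean; [exact: ess_integrable|exact/ess_integrable/ess_cst|].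
  have start' : {ae P, forall w, forall i, A i 0%N w <= alpha * n}.
    exact: filter_forall.
  apply: filterS2 walk_regular start' => w /(_ 0%N)[sx _] lea.
  rewrite expr2 mulrA -[X in _ <= _ * X](state_total sx) mulr_sumr.
  apply: ler_sum => i _; rewrite (@le_trans _ _ (A i 0%N w ^+ 2))//.
    rewrite lerXn2r ?nnegrE ?excess_ge0 ?(state_ge0 sx)//.
    by rewrite excess_le ?(ltW en0) ?(state_ge0 sx).
  by rewrite expr2 ler_wpM2r ?(state_ge0 sx).
have Vt : (1 - e) ^+ 2 * n ^+ 2 * (1 - q t) <= V t.
  have i2 : P.-integrable setT (EFin \o (fun w => (2 <= N t w)%N%:R : R)).
    exact/ess_integrable/(@ess_nalive t (fun r => (2 <= r)%N%:R)).
  have i1 : P.-integrable setT (EFin \o (fun w : T => 1 : R)).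
    exact/ess_integrable/ess_cst.
  have <- : \int[P]_w ((1 - e) ^+ 2 * n ^+ 2 * (1 - (2 <= N t w)%N%:R)) =
            (1 - e) ^+ 2 * n ^+ 2 * (1 - q t).
    rewrite RintegralZl//; last exact: (integrableB measurableT i1 i2).
    by rewrite RintegralB// mean_cst.
  apply: ae_le_mean.
  - by apply: integrable_scale; exact: (integrableB measurableT i1 i2).
  - exact: ess_integrable.
  - apply: filterS walk_regular => w /(_ t)[sx _].
    have ge0 : 0 <= \sum_(i < m) excess (e * n) (A i t w) ^+ 2.
      by rewrite sumr_ge0// => i _; exact: sqr_ge0.
    case: (leqP 2 (N t w)) => /= [_|N2]; first by rewrite subrr mulr0.
    have N1 : N t w = 1%N.
      by apply/eqP; rewrite eqn_leq -ltnS N2 (nalive_gt0 n0 sx).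
    have [i xi _] := nalive1 sx N1.
    rewrite subr0 mulr1 (bigD1 i)//= ler_wpDr//.
      by rewrite sumr_ge0// => j _; exact: sqr_ge0.
    move: xi; rewrite /conf => ->.
    rewrite -exprMn lerXn2r ?nnegrE ?excess_ge0//.
      by rewrite mulr_ge0 ?subr_ge0 ?(ltW n0).
    by rewrite /excess mulrBl mul1r le_max lexx.
rewrite mean_absorption_time_series.
apply: (@le_trans _ _ (\sum_(0 <= s < t) (q s)%:E)%E); last first.
  by apply: nneseries_lim_ge => s _ _; rewrite lee_fin unabsorbed_ge0.
rewrite sumEFin lee_fin mulrAC ler_pdivrMr// [leRHS]mulrC.
apply: le_trans drift.
have St := mean_square_le t; have S0 := mean_square_ge0 0.
have n20 := sqr_ge0 n.
have h1 : (1 - 3 * e) * n ^+ 2 <= V t.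
  apply: le_trans Vt; rewrite mulrAC; apply: ler_wpM2r => //.
  apply: (@le_trans _ _ ((1 - e) ^+ 2 * (1 - e))); first by nra.
  by apply: ler_wpM2l; [exact: sqr_ge0|lra].
have h2 : e * (S t - S 0%N) <= e * n ^+ 2 by apply: ler_wpM2l; [exact: ltW|lra].
lra.
Qed.

End walk.

Theorem theorem2p7 (R : realType) (alpha aminus aplus : R)
    (pminus pplus : nat -> R)
    (halpha : alpha < 1) (haminus : 0 < aminus) (haplus : 0 < aplus)
    (hpminus : Omega_inv pminus) (hpplus : O_inv pplus) :
  exists beta c C : R, [/\ 0 < beta, 0 < c, 0 < C &
    forall (d : measure_display) (T : measurableType d) (P : probability T R)
      (F : nat -> set (set T)) (n : R) (m : nat)
      (A : 'I_m -> nat -> T -> R),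
      0 < n -> (2 <= m)%N -> beta < n / m%:R ->
      sticky_random_walk P F n pminus pplus aminus aplus A ->
      (forall i, {ae P, forall w, A i 0%N w <= alpha * n}) ->
      ((c * n ^+ 2)%:E <= \int[P]_w absorption_time A w <= (C * n ^+ 2)%:E)%E].
Proof.
have [k k0 hk] := hpminus; have [K K0 hK] := hpplus.
(* This makes 1 - alpha - 4 e positive; the minimum with 1 matters when
   alpha is very negative. *)
pose e := Num.min 1 ((1 - alpha) / 8).
have e0 : 0 < e by rewrite lt_min ltr01 divr_gt0// subr_gt0.
have e1 : e <= 1 by rewrite ge_min lexx.
have ea : e <= (1 - alpha) / 8 by rewrite ge_min lexx orbT.
pose D := drift_bound aminus aplus k K e.
have c0 : 0 < k * aminus ^+ 2 by rewrite mulr_gt0 ?exprn_gt0.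
have L0 : 0 < 2 / e * aplus ^+ 2 by rewrite mulr_gt0 ?exprn_gt0 ?divr_gt0.
have D0 : 0 < D.
  by rewrite ltr_wpDr// divr_ge0 ?sqr_ge0// mulr_ge0// mulr_ge0// ltW.
exists (2 * aplus / e), ((1 - alpha - 4 * e) / D), (k * aminus ^+ 2)^-1; split.
- by rewrite divr_gt0 ?mulr_gt0.
- by rewrite divr_gt0//; lra.
- by rewrite invr_gt0.
move=> d T P F n m A n0 m2 beta_lt walk start; apply/andP; split; last first.
  exact: (mean_absorption_time_le haminus n0 k0 hk hK walk).
apply: (mean_absorption_time_ge haminus haplus n0 k0 K0 hk hK walk) => //.
  by lra.
(* The choice of beta is what bounds one jump, at most m aplus, by e n / 2. *)
have m0 : 0 < (m%:R : R) by rewrite ltr0n; exact: leq_trans m2.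
by move: beta_lt; rewrite ltr_pdivrMr// mulrAC ltr_pdivlMr// => ?; lra.
Qed.
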